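(* Let $\Psi(s)=C(sI_n-A)^{-1}B+D$ be a $p\times p$-valued rational function of McMillan degree $q$, where $A\in\mathbb{C}^{n\times n}$, $B\in\mathbb{C}^{n\times p}$, $C\in\mathbb{C}^{p\times n}$, $D\in\mathbb{C}^{p\times p}$ and $n\geq q$. Put $$L:=\begin{pmatrix}A&B\\ C&D\end{pmatrix}\in\mathbb{C}^{(n+p)\times(n+p)} .$$ Assume that $$HL+L^*H\in\overline{\mathbb{P}}_{n+p},\qquad H=\mathrm{diag}\{\hat H,\,I_p\},$$ where $\hat H\in\mathbb{C}^{n\times n}$ is Hermitian. (I) If $\mathrm{inertia}(\hat H)=(\nu,0,n-\nu)$ for some $\nu\in[0,n]$, then $\Psi$ is a generalized positive function ($\Psi\in\mathcal{GP}$) with at most $\nu$ poles in $\mathbb{C}_-$ and at most $n-\nu$ poles in $\mathbb{C}_+$. (II) If in part (I) $-\hat H\in\mathbb{P}_n$ (i.e. $\nu=n$), then $\Psi$ is a positive function ($\Psi\in\mathcal{P}$).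
   Context: $\mathbb{C}_+$ and $\mathbb{C}_-$ are the open right and left half planes. $\mathbb{P}_k$ (resp. $\overline{\mathbb{P}}_k$) is the set of $k\times k$ Hermitian positive definite (resp. positive semidefinite) complex matrices. For a square matrix $A$, $\mathrm{inertia}(A)=(\nu,\delta,\pi)$ means that $A$ has $\nu$ eigenvalues in $\mathbb{C}_-$, $\delta$ eigenvalues on $i\mathbb{R}$ and $\pi$ eigenvalues in $\mathbb{C}_+$. A $p\times p$-valued rational function $F$ is positive ($F\in\mathcal{P}$) if it is analytic in $\mathbb{C}_+$ and $F(s)+F(s)^*\in\overline{\mathbb{P}}_p$ for all $s\in\mathbb{C}_+$. It is generalized positive ($F\in\mathcal{GP}$) if $F(i\omega)+F(i\omega)^*\in\overline{\mathbb{P}}_p$ for almost every $\omega\in\mathbb{R}$. The realization is not assumed to be minimal (minimal means $n=q$). *)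

(* Defs.v *)
From HB Require Import structures.
From mathcomp Require Export all_boot all_order all_algebra.
From mathcomp Require Export generic_quotient sesquilinear spectral complex.
From mathcomp Require Export all_classical all_reals all_analysis.

Set Implicit Arguments.
Unset Strict Implicit.
Unset Printing Implicit Defensive.

Import Order.TTheory GRing.Theory Num.Theory.
Export numFieldNormedType.Exports.

Global Open Scope classical_set_scope.
Global Open Scope ring_scope.
Global Open Scope sesquilinear_scope.
Global Open Scope complex_scope.

Section SemidefiniteMatrices.
Variables (C : numClosedFieldType) (k : nat).

(* In the order of C, [0 <= z] (resp. [0 < z]) entails that z is real. *)
Definition posdefmx (M : 'M[C]_k) : Prop :=
  M \is hermsymmx /\
  forall x : 'cV[C]_k, x != 0 -> 0 < (x ^t* *m M *m x) ord0 ord0.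

Definition possemidefmx (M : 'M[C]_k) : Prop :=
  M \is hermsymmx /\
  forall x : 'cV[C]_k, 0 <= (x ^t* *m M *m x) ord0 ord0.

End SemidefiniteMatrices.

(* The roots of p (p != 0), listed with multiplicity. *)
Definition rootseq (C : closedFieldType) (p : {poly C}) : seq C :=
  sval (closed_field_poly_normal p).

(* Eigenvalues are counted with algebraic multiplicity. *)
Definition inertia (R : rcfType) (k : nat) (M : 'M[R[i]]_k) : nat * nat * nat :=
  let eigs := rootseq (char_poly M) in
  (count (fun z => complex.Re z < 0) eigs,
   count (fun z => complex.Re z == 0) eigs,
   count (fun z => 0 < complex.Re z) eigs).

Notation ratfun K := {fraction {poly K}}.

Section RationalFunctions.
Variable K : fieldType.

(* Numerator and denominator of a rational function in lowest terms; [repr f]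
   is an arbitrary representative of the fraction f. *)
Definition rnum (f : ratfun K) : {poly K} :=
  let u := frac (repr f) in u.1 %/ gcdp u.1 u.2.
Definition rden (f : ratfun K) : {poly K} :=
  let u := frac (repr f) in u.2 %/ gcdp u.1 u.2.

(* The value at a pole is the dummy value 0. *)
Definition reval (f : ratfun K) (s : K) : K := (rnum f).[s] / (rden f).[s].

Definition rmx_eval m n (F : 'M[ratfun K]_(m, n)) (s : K) : 'M[K]_(m, n) :=
  map_mx (fun f => reval f s) F.

Definition const_ratfun (c : K) : ratfun K := tofrac c%:P.

(* C (s I - A)^-1 B + D; note that [char_poly_mx A] is 'X I - A. *)
Definition transfer_function n p (A : 'M[K]_n) (B : 'M[K]_(n, p))
    (C : 'M[K]_(p, n)) (D : 'M[K]_p) : 'M[ratfun K]_p :=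
  map_mx const_ratfun C *m invmx (map_mx (@tofrac _) (char_poly_mx A))
    *m map_mx const_ratfun B + map_mx const_ratfun D.

Definition lcmp (u v : {poly K}) : {poly K} := u * v %/ gcdp u v.

(* Smith-McMillan pole polynomial: the least common denominator of all the
   minors of F of all orders.  Index functions that are not injective only
   contribute zero minors, whose denominator is a constant.  The multiplicity
   of a root of this polynomial is the McMillan multiplicity of the pole. *)
Definition pole_poly m n (F : 'M[ratfun K]_(m, n)) : {poly K} :=
  \big[lcmp/1]_(k < (minn m n).+1)
    \big[lcmp/1]_(fg : {ffun 'I_k -> 'I_m} * {ffun 'I_k -> 'I_n})
      rden (\det (mxsub fg.1 fg.2 F)).

(* McMillan multiplicity of the pole at infinity: the largest order of a pole
   at infinity among all the minors (truncated subtraction). *)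
Definition pole_mult_infty m n (F : 'M[ratfun K]_(m, n)) : nat :=
  \max_(k < (minn m n).+1)
    \max_(fg : {ffun 'I_k -> 'I_m} * {ffun 'I_k -> 'I_n})
      (size (rnum (\det (mxsub fg.1 fg.2 F))) -
       size (rden (\det (mxsub fg.1 fg.2 F))))%N.

Definition mcmillan_degree m n (F : 'M[ratfun K]_(m, n)) : nat :=
  ((size (pole_poly F)).-1 + pole_mult_infty F)%N.

End RationalFunctions.

Section PositiveFunctions.
Variables (R : realType) (p : nat).
Implicit Type F : 'M[ratfun R[i]]_p.

(* Poles in the open left and right half planes, counted with McMillan
   multiplicity. *)
Definition nb_poles_left F : nat :=
  count (fun z => complex.Re z < 0) (rootseq (pole_poly F)).
Definition nb_poles_right F : nat :=
  count (fun z => 0 < complex.Re z) (rootseq (pole_poly F)).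

(* Complex differentiability at every point of the open right half plane.  At a
   pole, [reval] is not continuous, whatever the dummy value. *)
Definition analytic_right F : Prop :=
  forall (i j : 'I_p) (s : R[i]), 0 < complex.Re s ->
    derivable (reval (F i j) : (R[i])^o -> (R[i])^o) s 1.

Definition positive_function F : Prop :=
  analytic_right F /\
  forall s : R[i], 0 < complex.Re s ->
    possemidefmx (rmx_eval F s + (rmx_eval F s) ^t*).

Definition generalized_positive_function F : Prop :=
  {ae (@lebesgue_measure R), forall w : R,
     possemidefmx (rmx_eval F (0 +i* w) + (rmx_eval F (0 +i* w)) ^t*)}.

End PositiveFunctions.

(* Main.v *)
(* With x = (sI - A)^-1 B u one has L (x, u) = (s x, Psi(s) u), so the hypothesis
   evaluated at (x, u) reads

     2 Re(s) x^* Hhat x + u^* (Psi(s) + Psi(s)^* ) u >= 0,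

   which gives the sign conditions on the imaginary axis and, for Hhat < 0, on
   the right half plane; there sI - A is invertible since an eigenvector x of A
   would satisfy 2 Re(s) x^* Hhat x >= 0.

   Every minor of Psi times det(sI - A) is the determinant of a polynomial
   matrix (Schur complement), hence the pole polynomial divides det(sI - A), and
   it remains to count the eigenvalues of A.  The form of Hhat is nonnegative on
   the A-invariant subspace of the eigenvalues in the right half plane, by
   Lyapunov's theorem; this subspace thus meets the negative eigenspace of Hhat
   trivially. *)

Require Import Defs.
From mathcomp Require Import ring.

Set Implicit Arguments.
Unset Strict Implicit.
Unset Printing Implicit Defensive.

Import Order.TTheory GRing.Theory Num.Theory.

(** * Rational functions and the pole polynomial *)

Lemma tofrac_repr (K : idomainType) (f : {fraction K}) :
  f * tofrac (frac (repr f)).2 = tofrac (frac (repr f)).1.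
Proof.
rewrite -{1}[f]reprK; set x := repr f.
rewrite !piE; apply/eqmodP => /=.
rewrite FracField.equivfE /FracField.mulf !numden_Ratio ?oner_neq0 ?mulr1 ?denom_ratioP //.
by rewrite mulrC.
Qed.

Section RationalFunctionValues.
Variable K : fieldType.
Implicit Types (f : ratfun K) (P Q : {poly K}).

Lemma rnum_rden_coprime f : coprimep (rnum f) (rden f).
Proof.
apply: coprimep_div_gcd; apply/orP; right; exact: denom_ratioP.
Qed.

Lemma rnum_rdenE f P Q : f * tofrac Q = tofrac P -> rnum f * Q = P * rden f.
Proof.
move=> fQ; have := tofrac_repr f; set u := frac (repr f) => fu.
have u0 : u.2 != 0 by exact: denom_ratioP.
have uPQ : u.1 * Q = P * u.2.
  apply/eqP; rewrite -tofrac_eq !tofracM -fu -fQ.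
  by rewrite mulrAC.
have g0 : gcdp u.1 u.2 != 0 by rewrite gcdp_eq0 negb_and u0 orbT.
apply: (mulIf g0); rewrite /rnum /rden -/u mulrAC divpK ?dvdp_gcdl //.
by rewrite -mulrA divpK ?dvdp_gcdr.
Qed.

(** Gauss's lemma: [rden f] divides [rnum f * Q] and is coprime to [rnum f]. *)
Lemma rden_dvdp f P Q : f * tofrac Q = tofrac P -> rden f %| Q.
Proof.
move=> /rnum_rdenE fQ.
rewrite -(Gauss_dvdpr Q (q := rnum f)); last by rewrite coprimep_sym rnum_rden_coprime.
by rewrite fQ dvdp_mull.
Qed.

(** A root of [rden f] would be a root of [Q], so [reval] does not meet its dummy value at [s] and
    cross-multiplication applies. *)
Lemma revalE f P Q s : f * tofrac Q = tofrac P -> Q.[s] != 0 ->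
  reval f s = P.[s] / Q.[s].
Proof.
move=> fQ Qs.
have ds : (rden f).[s] != 0.
  apply: contraNneq Qs => ds; have /dvdpP [c ->] := rden_dvdp fQ.
  by rewrite hornerM ds mulr0.
have /(congr1 (horner^~ s)) := rnum_rdenE fQ.
by rewrite !hornerM => e; apply/eqP; rewrite /reval eqr_div // e.
Qed.

Lemma lcmp_dvdp (u v w : {poly K}) : u %| w -> v %| w -> lcmp u v %| w.
Proof.
rewrite /lcmp => uw vw; have [g0|g0] := eqVneq (gcdp u v) 0.
  by move/eqP: g0 uw; rewrite gcdp_eq0 => /andP[/eqP-> _]; rewrite mul0r div0p.
(* Multiplying by the gcd turns the claim into [u * v %| w * gcdp u v], whose right side is
   [gcdp (w * u) (w * v)] up to a unit. *)
rewrite -(dvdp_mul2r _ _ g0) divpK ?(dvdp_trans (dvdp_gcdl u v)) ?dvdp_mulIl //.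
rewrite (eqp_dvdr _ (mulp_gcdr u v w)) dvdp_gcd [w * u]mulrC.
by rewrite !dvdp_mul.
Qed.

End RationalFunctionValues.

Section TransferFunction.
Variables (K : fieldType) (n p : nat).
Variables (A : 'M[K]_n) (B : 'M[K]_(n, p)) (C : 'M[K]_(p, n)) (D : 'M[K]_p).

Local Notation cst := (map_mx (@polyC K)).
Local Notation frac := (map_mx (@tofrac {poly K})).

Lemma map_const_ratfun m k (M : 'M[K]_(m, k)) : map_mx (@const_ratfun K) M = frac (cst M).
Proof. by apply/matrixP => i j; rewrite !mxE. Qed.

Lemma transfer_functionE :
  transfer_function A B C D =
  frac (cst C) *m invmx (frac (char_poly_mx A)) *m frac (cst B) + frac (cst D).
Proof. by rewrite /transfer_function !map_const_ratfun. Qed.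

Lemma frac_char_poly_unit : frac (char_poly_mx A) \in unitmx.
Proof.
by rewrite unitmxE det_map_mx unitfE tofrac_eq0 monic_neq0 ?char_poly_monic.
Qed.

(** Cramer's rule: the numerator of the transfer function over the common denominator
    [char_poly A]. *)
Definition transfer_num : 'M[{poly K}]_p :=
  cst C *m \adj (char_poly_mx A) *m cst B + char_poly A *: cst D.

Lemma transfer_function_num i j :
  transfer_function A B C D i j * tofrac (char_poly A) = tofrac (transfer_num i j).
Proof.
pose Psi := transfer_function A B C D.
suff : tofrac (char_poly A) *: Psi = frac transfer_num.
  by move/matrixP/(_ i j); rewrite !mxE mulrC.
rewrite /Psi transfer_functionE /transfer_num [RHS]map_mxD !map_mxM map_mxZ scalerDr.
rewrite map_mx_adj /invmx frac_char_poly_unit det_map_mx -scalemxAr -scalemxAl scalerA.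
by rewrite divff ?scale1r // tofrac_eq0 monic_neq0 ?char_poly_monic.
Qed.

(* The minor is a Schur complement of the polynomial matrix
   [[sI - A, B_g], [- C_f, D_fg]]. *)
Lemma transfer_minor_rden k (f g : 'I_k -> 'I_p) :
  rden (\det (mxsub f g (transfer_function A B C D))) %| char_poly A.
Proof.
pose M := block_mx (char_poly_mx A) (cst (colsub g B)) (- cst (rowsub f C)) (cst (mxsub f g D)).
apply: (@rden_dvdp _ _ (\det M)).
rewrite -!det_map_mx map_block_mx map_mxN.
set X := frac (char_poly_mx A).
have uX : X \in unitmx := frac_char_poly_unit.
set b := frac (cst _); set c := frac (cst (rowsub _ _)); set d := frac (cst _).
have -> : mxsub f g (transfer_function A B C D) = c *m invmx X *m b + d.
  rewrite transfer_functionE -/X /b /c /d.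
  apply/matrixP => i j; rewrite !mxE; congr (_ + _).
  apply: eq_bigr => l _; rewrite !mxE; congr (_ * _).
  by apply: eq_bigr => m _; rewrite !mxE.
have -> : block_mx X b (- c) d =
    block_mx 1%:M 0 (- c *m invmx X) 1%:M *m block_mx X b 0 (c *m invmx X *m b + d).
  rewrite mulmx_block !mul1mx !mul0mx !addr0 mulmxKV //.
  by rewrite !mulNmx addrA addNr add0r.
by rewrite det_mulmx det_lblock !det1 !mul1r det_ublock mulrC.
Qed.

Lemma pole_poly_dvdp : pole_poly (transfer_function A B C D) %| char_poly A.
Proof.
rewrite /pole_poly; elim/big_ind: _ => [|u v|k _]; rewrite ?dvd1p //; first exact: lcmp_dvdp.
elim/big_ind: _ => [|u v|fg _]; rewrite ?dvd1p //; first exact: lcmp_dvdp.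
exact: transfer_minor_rden.
Qed.

End TransferFunction.

(** * Roots, eigenvalues and invariant subspaces *)

Section RootSequences.
Variable F : closedFieldType.

Lemma rootseqE (p : {poly F}) :
  p = lead_coef p *: \prod_(z <- rootseq p) ('X - z%:P).
Proof. exact: svalP (closed_field_poly_normal p). Qed.

(** Unique factorization determines [rootseq], an arbitrary choice of factorization, up to
    permutation. *)
Lemma perm_rootseq (p : {poly F}) (s : seq F) c :
  c != 0 -> p = c *: \prod_(z <- s) ('X - z%:P) -> perm_eq (rootseq p) s.
Proof.
move=> c0 pE; apply: prod_XsubC_eq.
have lp : lead_coef p = c by rewrite pE lead_coefZ (eqP (monic_prod_XsubC _ _ _)) mulr1.
have := rootseqE p; rewrite lp {1}pE => /(congr1 ( *:%R c^-1)).
by rewrite !scalerA mulVf // !scale1r.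
Qed.

Lemma rootseqM (p q : {poly F}) : p != 0 -> q != 0 ->
  perm_eq (rootseq (p * q)) (rootseq p ++ rootseq q).
Proof.
move=> p0 q0; apply: (@perm_rootseq _ _ (lead_coef p * lead_coef q)).
  by rewrite mulf_neq0 // lead_coef_eq0.
rewrite {1}(rootseqE p) {1}(rootseqE q).
by rewrite big_cat /= -scalerAl -scalerAr scalerA.
Qed.

Lemma rootseq_XsubC (a : F) : perm_eq (rootseq ('X - a%:P)) [:: a].
Proof. by apply: (@perm_rootseq _ _ 1); rewrite ?oner_neq0 // big_seq1 scale1r. Qed.

Lemma count_rootseq_dvdp (P : pred F) (p q : {poly F}) : q != 0 -> p %| q ->
  (count P (rootseq p) <= count P (rootseq q))%N.
Proof.
move=> q0 /dvdpP [r qE]; move: q0; rewrite qE mulf_eq0 negb_or => /andP[r0 p0].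
by rewrite (permP (rootseqM r0 p0)) count_cat leq_addl.
Qed.

Lemma mem_rootseq (p : {poly F}) z : p != 0 -> (z \in rootseq p) = root p z.
Proof.
move=> p0; rewrite {2}(rootseqE p).
by rewrite rootZ ?lead_coef_eq0 // root_prod_XsubC.
Qed.

End RootSequences.

Section CharPoly.
Variable F : fieldType.

Lemma char_poly_similar n (A N S : 'M[F]_n) :
  S \in unitmx -> A *m S = S *m N -> char_poly A = char_poly N.
Proof.
move=> uS e.
have d0 : \det (map_mx (@polyC F) S) != 0 by rewrite det_map_mx polyC_eq0 -unitfE -unitmxE.
apply: (mulIf d0); rewrite /char_poly [RHS]mulrC -!det_mulmx; congr (\det _).
by rewrite /char_poly_mx mulmxBl mulmxBr -!map_mxM e scalar_mxC.
Qed.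

(** [eigenvalue] is about row vectors; transposition gives access to column eigenvectors. *)
Lemma eigenvalue_trmx n (A : 'M[F]_n) a : eigenvalue A^T a = eigenvalue A a.
Proof.
rewrite !eigenvalue_root_char; congr (root _ _).
rewrite /char_poly -[RHS]det_tr; congr (\det _).
by rewrite /char_poly_mx linearB /= tr_scalar_mx map_trmx.
Qed.

Lemma eigenvalueN n (A : 'M[F]_n) a : eigenvalue (- A) a = eigenvalue A (- a).
Proof.
apply/eigenvalueP/eigenvalueP => -[v e v0]; exists v => //.
  by rewrite scaleNr -e mulmxN opprK.
by rewrite mulmxN e scaleNr opprK.
Qed.

(** One step of triangularization: an eigenvector is completed to a basis, the columns of [S]. *)
Lemma deflation n (A : 'M[F]_n.+1) a : eigenvalue A a ->
  exists (S : 'M[F]_(1 + n)) (b : 'rV[F]_n) (A' : 'M[F]_n),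
  [/\ S \in unitmx, A *m S = S *m block_mx a%:M b 0 A' &
     char_poly A = ('X - a%:P) * char_poly A'].
Proof.
rewrite -eigenvalue_trmx => /eigenvalueP [v vA v0].
pose U : 'M[F]_(1 + n) := row_ebase v; pose e : 'M[F]_(1, 1 + n) := row_mx 1%:M 0.
have uU : U \in unitmx := row_ebase_unit v.
(* As [v] has rank one, its rank factorization makes the first row of [row_ebase v] a scalar
   multiple of [v]. *)
have eU : e *m U = invmx (col_ebase v) *m v.
  rewrite -{2}(mulmx_ebase v) -!mulmxA mulKmx ?col_ebase_unit // rank_rV v0.
  by rewrite /e -pid_mx_row.
pose M : 'M[F]_(1 + n) := U *m A^T *m invmx U.
have eM : e *m M = a *: e.
  rewrite !mulmxA eU -(mulmxA _ v) vA -scalemxAr -scalemxAl -eU.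
  by rewrite mulmxK.
have MU : M *m U = U *m A^T by rewrite mulmxKV.
move: eM MU; rewrite -(submxK M) mul_row_block !mul1mx !mul0mx !addr0.
rewrite scale_row_mx scaler0 => /eq_row_mx [-> ->] MU.
have AS : A *m U^T = U^T *m block_mx a%:M (dlsubmx M)^T 0 (drsubmx M)^T.
  rewrite -[A]trmxK -trmx_mul -MU trmx_mul tr_block_mx trmx0.
  by rewrite scalemx1 tr_scalar_mx.
exists U^T, (dlsubmx M)^T, (drsubmx M)^T; split; rewrite ?unitmx_tr //.
have uS : U^T \in unitmx by rewrite unitmx_tr.
rewrite (char_poly_similar uS AS).
rewrite /char_poly /char_poly_mx map_block_mx scalar_mx_block opp_block_mx add_block_mx.
by rewrite map_mx0 oppr0 addr0 det_ublock det_mx11 !mxE eqxx !mulr1n.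
Qed.

Lemma eigenvalue_mx0 (A : 'M[F]_0) a : eigenvalue A a = false.
Proof. by rewrite eigenvalue_root_char /char_poly det_mx00 /root hornerC oner_eq0. Qed.

(* Column analogue of [row_free]. *)
Definition col_free m n (X : 'M[F]_(m, n)) := forall y : 'cV_n, X *m y = 0 -> y = 0.

Lemma col_free_leq m n (X : 'M[F]_(m, n)) : col_free X -> (n <= m)%N.
Proof.
move=> injX; have : row_free X^T.
  apply: inj_row_free => v vX; apply: trmx_inj; rewrite trmx0.
  by apply: injX; apply: trmx_inj; rewrite trmx_mul trmxK vX trmx0.
by rewrite -row_leq_rank mxrank_tr => /leq_trans; apply; exact: rank_leq_row.
Qed.

End CharPoly.

(** Induction on [n]: deflate at a root in [P], then lift an invariant subspace of the quotient
    [A']; the deflated eigenvector supplies the missing dimension. *)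
Lemma invariant_subspace (F : closedFieldType) (P : pred F) n (A : 'M[F]_n) :
  exists (X : 'M[F]_(n, count P (rootseq (char_poly A))))
         (T : 'M[F]_(count P (rootseq (char_poly A)))),
  [/\ A *m X = X *m T, col_free X & forall a, eigenvalue T a -> P a].
Proof.
(* The dimension becomes a variable [k], which frees the induction from the dependent sizes of [X]
   and [T]. *)
suff [k [X [T [<- ? ? ?]]]] : exists k (X : 'M[F]_(n, k)) (T : 'M[F]_k),
    [/\ k = count P (rootseq (char_poly A)), A *m X = X *m T, col_free X &
      forall a, eigenvalue T a -> P a] by exists X, T.
elim: n A => [|n IH] A; last first.
  have [/hasP[a aA Pa]|nP] := boolP (has P (rootseq (char_poly A))); last first.
    exists 0%N, 0, 0; split; last by move=> a; rewrite eigenvalue_mx0.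
    - by apply/esym/eqP; rewrite -leqn0 leqNgt -has_count.
    - by rewrite mulmx0 mul0mx.
    - by move=> y _; apply/matrixP => -[].
  have aeA : eigenvalue A a.
    by rewrite eigenvalue_root_char -mem_rootseq ?monic_neq0 ?char_poly_monic.
  have [S [b [A' [uS AS cA]]]] := deflation aeA.
  have [k [X [T [kE AX freeX PT]]]] := IH A'.
  (* In the basis [S] the subspace is spanned by the first basis vector and the columns of [X]; [A]
     acts on it by a triangular matrix with diagonal blocks [a] and [T]. *)
  exists (1 + k)%N, (S *m block_mx 1%:M 0 0 X), (block_mx a%:M (b *m X) 0 T); split.
  - rewrite cA (permP (rootseqM _ _)) ?polyXsubC_eq0 ?monic_neq0 ?char_poly_monic //.
    by rewrite count_cat (permP (rootseq_XsubC a)) /= Pa kE.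
  - rewrite mulmxA AS -!mulmxA !mulmx_block !mulmx0 !mul0mx !mulmx1 !mul1mx.
    by rewrite !addr0 !add0r AX.
  - move=> y; rewrite -mulmxA => /(congr1 (mulmx (invmx S))); rewrite mulKmx // mulmx0.
    rewrite -(vsubmxK y) mul_block_col mul1mx !mul0mx addr0 add0r.
    by rewrite -[in X in X -> _]col_mx0 => /eq_col_mx [-> /freeX ->]; rewrite col_mx0.
  - move=> c; rewrite eigenvalue_root_char /char_poly /char_poly_mx map_block_mx.
    rewrite scalar_mx_block opp_block_mx add_block_mx map_mx0 oppr0 addr0 det_ublock.
    rewrite det_mx11 !mxE eqxx !mulr1n rootM root_XsubC => /orP[/eqP->//|].
    by move=> rc; apply: PT; rewrite eigenvalue_root_char.
exists 0%N, 0, 0; split; last by move=> a; rewrite eigenvalue_mx0.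
- rewrite (permP (perm_rootseq (s := [::]) (c := 1) _ _)) ?oner_neq0 //.
  by rewrite /char_poly det_mx00 big_nil scale1r.
- by rewrite mulmx0 mul0mx.
- by move=> y _; apply/matrixP => -[].
Qed.

(** * Hermitian forms and the Lyapunov inequality *)

Section HermitianForms.
Variable F : numClosedFieldType.

Local Notation form M x := ((x ^t* *m M *m x) ord0 ord0).

Lemma adjmxM m n k (X : 'M[F]_(m, n)) (Y : 'M[F]_(n, k)) : (X *m Y) ^t* = Y ^t* *m X ^t*.
Proof. by rewrite trmx_mul map_mxM. Qed.

Lemma adjmxD m n (X Y : 'M[F]_(m, n)) : (X + Y) ^t* = X ^t* + Y ^t*.
Proof. by rewrite linearD /= map_mxD. Qed.

Lemma adjmxN m n (X : 'M[F]_(m, n)) : (- X) ^t* = - X ^t*.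
Proof. by rewrite linearN /= map_mxN. Qed.

Lemma adjmxZ m n a (X : 'M[F]_(m, n)) : (a *: X) ^t* = Num.conj a *: X ^t*.
Proof. by rewrite linearZ /= map_mxZ. Qed.

Lemma hermsymmxP n (M : 'M[F]_n) : reflect (M ^t* = M) (M \is hermsymmx).
Proof.
apply: (iffP (is_hermitianmxP _ _ _)); rewrite expr0 scale1r => e; last by rewrite e.
exact/esym.
Qed.

Lemma hermsymmxN n (M : 'M[F]_n) : M \is hermsymmx -> - M \is hermsymmx.
Proof. by move=> /hermsymmxP hM; apply/hermsymmxP; rewrite adjmxN hM. Qed.

Lemma hermsymmx_congr m n (M : 'M[F]_m) (S : 'M[F]_(m, n)) :
  M \is hermsymmx -> S ^t* *m M *m S \is hermsymmx.
Proof.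
by move=> /hermsymmxP hM; apply/hermsymmxP; rewrite !adjmxM trmxCK hM mulmxA.
Qed.

Lemma adj_sqnorm n (x : 'cV[F]_n) : (x ^t* *m x) 0 0 = \sum_i `|x i 0| ^+ 2.
Proof. by rewrite !mxE; apply: eq_bigr => i _; rewrite !mxE mulrC normCK. Qed.

Lemma adj_sqnorm_ge0 n (x : 'cV[F]_n) : 0 <= (x ^t* *m x) 0 0.
Proof. by rewrite adj_sqnorm sumr_ge0 // => i _; rewrite exprn_ge0. Qed.

Lemma adj_sqnorm_eq0 n (x : 'cV[F]_n) : (x ^t* *m x) 0 0 = 0 -> x = 0.
Proof.
rewrite adj_sqnorm => /eqP; rewrite psumr_eq0 => [/allP x0|i _]; last by rewrite exprn_ge0.
apply/colP => i; rewrite mxE; have := x0 i (mem_index_enum i).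
by rewrite expf_eq0 normr_eq0 => /eqP.
Qed.

Lemma possemidefmx_congr m n (M : 'M[F]_m) (S : 'M[F]_(m, n)) :
  possemidefmx M -> possemidefmx (S ^t* *m M *m S).
Proof.
move=> [hM pM]; split=> [|x]; first exact: hermsymmx_congr.
by have := pM (S *m x); rewrite adjmxM !mulmxA.
Qed.

Lemma possemidefmx_congr_unit n (M S : 'M[F]_n) : S \in unitmx ->
  possemidefmx (S ^t* *m M *m S) -> possemidefmx M.
Proof.
move=> uS /(possemidefmx_congr (invmx S)); rewrite !mulmxA mulmxK //.
by rewrite -adjmxM mulmxV // trmx1 map_mx1 mul1mx.
Qed.

Lemma possemidefmx_adj_mul m n (X : 'M[F]_(m, n)) : possemidefmx (X ^t* *m X).
Proof.
split=> [|x]; first by apply/hermsymmxP; rewrite adjmxM trmxCK.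
have -> : x ^t* *m (X ^t* *m X) *m x = (X *m x) ^t* *m (X *m x) by rewrite adjmxM !mulmxA.
exact: adj_sqnorm_ge0.
Qed.

(** At [x - t *: (M *m x)] the form has no constant term and its linear term is -2 t |M x|^2, so a
    small t > 0 would make it negative if M x were nonzero. *)
Lemma possemidefmx_null n (M : 'M[F]_n) (x : 'cV[F]_n) :
  possemidefmx M -> form M x = 0 -> M *m x = 0.
Proof.
move=> [/hermsymmxP hM pM] Mx0; set z := M *m x.
apply: adj_sqnorm_eq0; set N := (_ *m _) _ _.
have N0 : 0 <= N by exact: adj_sqnorm_ge0.
have c1 : 0 < form M z + 1 by rewrite ltr_wpDl.
(* Chosen so that [t * form M z = N - t], which brings the value of the form to [- t * (t + N)]; the
   summand 1 keeps the denominator positive. *)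
pose t := N / (form M z + 1).
have t0 : 0 <= t by rewrite divr_ge0 // ltW.
have tr : Num.conj t = t by apply/CrealP; exact: ger0_real.
have := pM (x - t *: z).
have xM : x ^t* *m M = z ^t* by rewrite /z adjmxM hM.
have -> : form M (x - t *: z) = t * (t * form M z - N - N).
  rewrite adjmxD adjmxN adjmxZ tr mulmxDl mulNmx -scalemxAl xM.
  rewrite mulmxDl !mulmxDr !mulNmx !mulmxN -!scalemxAl -!scalemxAr -mulmxA -/z.
  have zx0 : (z ^t* *m x) 0 0 = 0 by rewrite -xM.
  have -> : N = (z ^t* *m z) 0 0 by [].
  move: zx0; set u := z ^t* *m x; set v := z ^t* *m z; set w := z ^t* *m M *m z.
  by clearbody u v w; rewrite !mxE => ->; ring.
have tcE : t * form M z = N - t.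
  by apply/(canRL (addrK _)); rewrite -[X in _ + X]mulr1 -mulrDr divfK // gt_eqF.
rewrite tcE => le0; apply/eqP; apply: contraTT le0 => N_neq0.
have N_gt0 : 0 < N by rewrite lt_def N_neq0.
have t_gt0 : 0 < t by rewrite mulr_gt0 ?invr_gt0.
rewrite lt_geF //; have -> : N - t - N - N = - (t + N) by ring.
by rewrite pmulr_rlt0 // oppr_lt0 addr_gt0.
Qed.

(** A nonzero [g] would be a left eigenvector of [T] for [- Num.conj a], which lies outside the open
    right half plane. *)
Lemma eigenvalue_add_conj_null n (T : 'M[F]_n) a (g : 'rV[F]_n) :
  (forall c, eigenvalue T c -> 0 < c + Num.conj c) -> 0 <= a + Num.conj a ->
  g *m T + Num.conj a *: g = 0 -> g = 0.
Proof.
move=> pT a0 /eqP; rewrite addr_eq0 -scaleNr => /eqP gT.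
apply/eqP; apply: contraTT a0 => g0.
have /pT : eigenvalue T (- Num.conj a) by apply/eigenvalueP; exists g.
by rewrite rmorphN /= conjCK -opprD addrC oppr_gt0 => /lt_geF ->.
Qed.

(* With A block upper triangular, positivity of the corner of H A + A^* H forces
   the corner h of H to be nonnegative, and the first row of H to vanish if
   h = 0; the Schur complement of h in H then satisfies the same inequality. *)
Lemma lyapunov_possemidef n (T H : 'M[F]_n) :
  (forall a, eigenvalue T a -> 0 < a + Num.conj a) ->
  H \is hermsymmx -> possemidefmx (H *m T + T ^t* *m H) -> possemidefmx H.
Proof.
elim: n T H => [|n IH] T H pT hH pK.
  by split=> // x; rewrite mxE big_ord0.
have [a aT] : exists a, eigenvalue T a by exact: eigenvalue_closed.
have [S [b [T' [uS TS cT]]]] := deflation aT.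
have a_gt0 : 0 < a + Num.conj a by exact: pT.
have pT' c : eigenvalue T' c -> 0 < c + Num.conj c.
  rewrite eigenvalue_root_char => rc; apply: pT.
  by rewrite eigenvalue_root_char cT rootM rc orbT.
apply: (possemidefmx_congr_unit uS).
set T1 := block_mx a%:M b 0 T' in TS.
have KE : S ^t* *m (H *m T + T ^t* *m H) *m S =
    S ^t* *m H *m S *m T1 + T1 ^t* *m (S ^t* *m H *m S).
  rewrite mulmxDr mulmxDl !mulmxA; congr (_ + _); first by rewrite -mulmxA TS mulmxA.
  by rewrite -adjmxM TS adjmxM.
move: (possemidefmx_congr S pK) (hermsymmx_congr S hH); rewrite KE.
move: {H hH pK KE} (S ^t* *m H *m S) => H pK hH.
pose E : 'M[F]_(1 + n, 1) := col_mx 1%:M 0.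
pose h := form H E; pose g : 'rV[F]_n := ursubmx (H : 'M[F]_(1 + n)).
(* [W] spans a complement of [E] that is H-orthogonal to it. If [h = 0] then [h^-1 = 0] by
   convention, and orthogonality rests on [g = 0], which [hg] covers. *)
pose W : 'M[F]_(1 + n, n) := col_mx (- h^-1 *: g) 1%:M.
have hHE := hermsymmxP _ hH.
have EE : E ^t* = row_mx 1%:M 0.
  by rewrite tr_col_mx map_row_mx trmx1 map_mx1 trmx0 map_mx0.
have HE : E ^t* *m (H : 'M[F]_(1 + n)) = row_mx h%:M g.
  rewrite /h /g EE -{1 2}(submxK (H : 'M[F]_(1 + n))) mul_row_block !mul1mx !mul0mx !addr0.
  by rewrite mul_row_col mulmx1 mulmx0 addr0 -mx11_scalar.
have T1E : T1 *m E = a *: E.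
  by rewrite mul_block_col !mulmx0 !mulmx1 !addr0 scale_col_mx scalemx1 scaler0.
have KE : form (H *m T1 + T1 ^t* *m H) E = (a + Num.conj a) * h.
  rewrite mulmxDr mulmxDl mulmxA -mulmxA T1E !mulmxA -adjmxM T1E adjmxZ.
  by rewrite -scalemxAr -!scalemxAl -scalerDl mxE.
have h_ge0 : 0 <= h.
  by have := pK.2 E; rewrite KE pmulr_rge0.
have hg : (h * h^-1) *: g = g.
  have [h0|h0] := eqVneq h 0; last by rewrite divff // scale1r.
  (* For [h = 0] the form of the Lyapunov expression vanishes at [E], hence so does its product with
     [E]; the right block of the adjoint equation reads g T' + conj(a) g = 0. *)
  have /(congr1 (fun M => M ^t*)) : (H *m T1 + T1 ^t* *m H) *m E = 0.
    by apply: possemidefmx_null pK _; rewrite KE h0 mulr0.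
  rewrite adjmxM (hermsymmxP _ pK.1) mulmxDr !mulmxA -adjmxM T1E adjmxZ.
  rewrite -scalemxAl HE mul_row_block h0 scale_row_mx add_row_mx.
  rewrite trmx0 map_mx0 -row_mx0 => /eq_row_mx [_].
  rewrite mul_scalar_mx scale0r add0r => /(eigenvalue_add_conj_null pT' (ltW a_gt0)) ->.
  by rewrite scaler0.
have EHW : E ^t* *m H *m W = 0.
  rewrite HE mul_row_col mulmx1 mul_scalar_mx scalerA mulrN scaleNr hg.
  by rewrite addNr.
have WHE : W ^t* *m H *m E = 0.
  by have /(congr1 (fun M => M ^t*)) := EHW; rewrite !adjmxM trmxCK hHE mulmxA trmx0 map_mx0.
(* [W] is [T1]-invariant modulo [E], and [E] is H-orthogonal to [W]; so the compression of H to [W]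
   inherits the inequality, with [T']. *)
have [c T1W] : exists c, T1 *m W = W *m T' + E *m c.
  exists (a%:M *m (- h^-1 *: g) + b - (- h^-1 *: g) *m T').
  rewrite mul_block_col !mulmx1 mul0mx add0r !mul_col_mx !mul1mx mul0mx.
  by rewrite add_col_mx addr0 [in RHS]addrC subrK.
have pW : possemidefmx (W ^t* *m H *m W).
  apply: IH (hermsymmx_congr W hH) _; first exact: pT'.
  have := possemidefmx_congr W pK; congr possemidefmx.
  rewrite mulmxDr mulmxDl !mulmxA; congr (_ + _).
    by rewrite -[LHS]mulmxA T1W mulmxDr !mulmxA WHE mul0mx addr0.
  rewrite -[W ^t* *m T1 ^t*]adjmxM T1W adjmxD !adjmxM !mulmxDl -!mulmxA.
  by rewrite (mulmxA (E ^t*)) EHW mulmx0 addr0.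
split=> // x.
pose y : 'cV_n := dsubmx (x : 'cV_(1 + n)).
(* Completing the square: in the coordinates [z], [y] the cross terms vanish. *)
pose z : 'cV_1 := usubmx (x : 'cV_(1 + n)) + h^-1 *: (g *m y).
have -> : x = E *m z + W *m y.
  rewrite !mul_col_mx !mul1mx mul0mx add_col_mx add0r -scalemxAl scaleNr addrK.
  by rewrite vsubmxK.
clearbody z y.
rewrite adjmxD !adjmxM !(mulmxDl, mulmxDr) !mulmxA.
have -> : z ^t* *m E ^t* *m H *m W *m y = 0.
  by rewrite -2!(mulmxA (z ^t*)) EHW mulmx0 mul0mx.
have -> : y ^t* *m W ^t* *m H *m E *m z = 0.
  by rewrite -2!(mulmxA (y ^t*)) WHE mulmx0 mul0mx.
rewrite addr0 add0r -2!(mulmxA (z ^t*)) -2!(mulmxA (y ^t*)).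
rewrite [E ^t* *m H *m E]mx11_scalar -/h mul_mx_scalar -scalemxAl mxE [X in X + _]mxE.
by rewrite addr_ge0 ?pW.2 // mulr_ge0 // adj_sqnorm_ge0.
Qed.

(* The form of H is nonnegative on the A-invariant subspace spanned by X and
   negative on the H-invariant subspace spanned by N, so that the two are in
   direct sum. *)
Lemma invariant_subspaces_leq n k m (A H : 'M[F]_n) (X : 'M[F]_(n, k)) (T : 'M[F]_k)
    (N : 'M[F]_(n, m)) (U : 'M[F]_m) :
  H \is hermsymmx -> possemidefmx (H *m A + A ^t* *m H) ->
  A *m X = X *m T -> col_free X -> (forall a, eigenvalue T a -> 0 < a + Num.conj a) ->
  H *m N = N *m U -> col_free N -> (forall a, eigenvalue U a -> a + Num.conj a < 0) ->
  (k + m <= n)%N.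
Proof.
move=> hH pK AX freeX pT HN freeN pU; have hHE := hermsymmxP _ hH.
have pX : possemidefmx (X ^t* *m H *m X).
  apply: lyapunov_possemidef pT (hermsymmx_congr X hH) _.
  have := possemidefmx_congr X pK; congr possemidefmx.
  rewrite mulmxDr mulmxDl !mulmxA -adjmxM AX adjmxM; congr (_ + _).
  by rewrite -[LHS]mulmxA AX mulmxA.
pose G := N ^t* *m - H *m N.
have GE : G = - (N ^t* *m N *m U) by rewrite /G mulmxN mulNmx -mulmxA HN mulmxA.
have hG : G \is hermsymmx by apply: hermsymmx_congr; exact: hermsymmxN.
have pG : possemidefmx G.
  apply: (@lyapunov_possemidef _ (- U)) => // [a|].
    by rewrite eigenvalueN => /pU; rewrite rmorphN /= -opprD oppr_lt0.
  (* As [H *m N = N *m U], the Lyapunov expression of [G] and [- U] is twice the Gram matrix of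
     [H *m N]. *)
  have -> : G *m - U + (- U) ^t* *m G = (H *m N) ^t* *m (H *m N) + (H *m N) ^t* *m (H *m N).
    rewrite adjmxN mulmxN [(- _) *m G]mulNmx /G mulmxN !mulNmx mulmxN !opprK.
    congr (_ + _); first by rewrite adjmxM hHE -mulmxA -HN.
    by rewrite !mulmxA -adjmxM -HN.
  have [hM pM] := possemidefmx_adj_mul (H *m N).
  split=> [|x]; last by rewrite mulmxDr mulmxDl mxE addr_ge0.
  by apply/hermsymmxP; rewrite adjmxD (hermsymmxP _ hM).
(* A null vector of the form is killed by [G], so N^* N U z = 0; injectivity of [N] gives U z = 0,
   and 0 is not an eigenvalue of [U]. *)
have G_def (z : 'cV_m) : form G z = 0 -> z = 0.
  move=> /(possemidefmx_null pG); rewrite GE mulNmx => /eqP; rewrite oppr_eq0 => /eqP NUz.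
  have /freeN Uz : N *m (U *m z) = 0.
    by apply: adj_sqnorm_eq0; rewrite adjmxM -mulmxA (mulmxA (N ^t*)) (mulmxA _ U) NUz mulmx0 mxE.
  apply/eqP; apply: contraTT isT => z0.
  have /pU : eigenvalue U 0.
    rewrite -eigenvalue_trmx; apply/eigenvalueP; exists z^T; last by rewrite trmx_eq0.
    by rewrite -trmx_mul Uz trmx0 scale0r.
  by rewrite rmorph0 addr0 ltxx.
apply: (@col_free_leq _ _ _ (row_mx X N)) => v.
rewrite -(vsubmxK v) mul_row_col; move: (usubmx v) (dsubmx v) => y z XN0.
have XyE : X *m y = - (N *m z) by apply/eqP; rewrite -addr_eq0 XN0.
(* On a vector common to both images, the form of [H] is nonnegative through [X] and nonpositive
   through [N]. *)
have fE : form (X ^t* *m H *m X) y = - form G z.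
  have -> : y ^t* *m (X ^t* *m H *m X) *m y = (X *m y) ^t* *m H *m (X *m y).
    by rewrite adjmxM !mulmxA.
  rewrite XyE adjmxN mulmxN !mulNmx opprK /G mulmxN !mulNmx mulmxN mulNmx adjmxM !mulmxA.
  by rewrite !mxE opprK.
have z0 : z = 0.
  apply/G_def/eqP; rewrite eq_le pG.2 andbT -oppr_ge0 -fE; exact: pX.2.
by move: XyE; rewrite z0 mulmx0 oppr0 => /freeX ->; rewrite col_mx0.
Qed.

End HermitianForms.

(** * Values of the transfer function *)

Section TransferFunctionEvaluation.
Variables (K : fieldType) (n p : nat).
Variables (A : 'M[K]_n) (B : 'M[K]_(n, p)) (C : 'M[K]_(p, n)) (D : 'M[K]_p).

Lemma horner_char_poly s : (char_poly A).[s] = \det (s%:M - A).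
Proof.
rewrite -[LHS]/(horner_eval s _) /char_poly -det_map_mx; congr (\det _).
by apply/matrixP => i j; rewrite !mxE /= /horner_eval !hornerE hornerMn hornerX.
Qed.

Lemma char_poly_resolvent_unit s : (char_poly A).[s] != 0 -> s%:M - A \in unitmx.
Proof. by rewrite horner_char_poly unitmxE unitfE. Qed.

Lemma transfer_function_eval s : (char_poly A).[s] != 0 ->
  rmx_eval (transfer_function A B C D) s = C *m invmx (s%:M - A) *m B + D.
Proof.
move=> chi0; pose ev m k := @map_mx _ _ (horner_eval s) m k.
have evC m k (M : 'M[K]_(m, k)) : ev m k (map_mx (@polyC K) M) = M.
  by apply/matrixP => i j; rewrite !mxE /horner_eval hornerC.
have evX : ev n n (char_poly_mx A) = s%:M - A.
  by apply/matrixP => i j; rewrite !mxE /= /horner_eval !hornerE hornerMn hornerX.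
have evN : ev p p (transfer_num A B C D) =
    C *m \adj (s%:M - A) *m B + (char_poly A).[s] *: D.
  rewrite /ev /transfer_num map_mxD !map_mxM map_mxZ map_mx_adj.
  by rewrite [map_mx _ (char_poly_mx A)]evX ![map_mx _ (map_mx _ _)]evC.
have -> : rmx_eval (transfer_function A B C D) s =
    (char_poly A).[s]^-1 *: ev p p (transfer_num A B C D).
  apply/matrixP => i j; rewrite mxE (revalE (transfer_function_num A B C D i j) chi0).
  by rewrite mulrC 2![in RHS]mxE.
rewrite evN scalerDr scalerA mulVf // scale1r /invmx char_poly_resolvent_unit //.
by rewrite -horner_char_poly -scalemxAr -scalemxAl.
Qed.

End TransferFunctionEvaluation.

(** * The dissipation inequality and the eigenvalue counts *)

Section Dissipation.
Variables (F : numClosedFieldType) (n p : nat).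
Variables (A : 'M[F]_n) (B : 'M[F]_(n, p)) (C : 'M[F]_(p, n)) (D : 'M[F]_p).
Variable Hhat : 'M[F]_n.

Local Notation L := (block_mx A B C D).
Local Notation H := (block_mx Hhat 0 0 1%:M : 'M[F]_(n + p)).
Local Notation K := (H *m L + L ^t* *m H).

Lemma possemidefmx_state : possemidefmx K -> possemidefmx (Hhat *m A + A ^t* *m Hhat).
Proof.
move=> /(possemidefmx_congr (col_mx 1%:M 0 : 'M[F]_(n + p, n))); congr possemidefmx.
rewrite !tr_block_mx !map_block_mx !mulmx_block add_block_mx.
rewrite tr_col_mx map_row_mx mul_row_block mul_row_col.
by rewrite !trmx1 !map_mx1 !trmx0 !map_mx0 !(mul1mx, mul0mx, mulmx1, mulmx0, addr0).
Qed.

(* Evaluate the form of K at (x, u) with x = (sI - A)^-1 B u, for which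
   L (x, u) = (s x, Psi(s) u). *)
Lemma dissipation s (X := invmx (s%:M - A) *m B) (Y := C *m X + D) :
  s%:M - A \in unitmx -> possemidefmx K ->
  possemidefmx ((s + Num.conj s) *: (X ^t* *m Hhat *m X) + (Y + Y ^t*)).
Proof.
move=> uM /(possemidefmx_congr (col_mx X 1%:M)); congr possemidefmx.
have AX : A *m X + B = s *: X.
  have : (s%:M - A) *m X = B by rewrite mulKVmx.
  by rewrite mulmxBl mul_scalar_mx => <-; rewrite addrC subrK.
clearbody X.
have LV : L *m col_mx X 1%:M = col_mx (s *: X) Y.
  by rewrite mul_block_col !mulmx1 AX.
have HV : (col_mx X 1%:M) ^t* *m H = row_mx (X ^t* *m Hhat) 1%:M.
  rewrite tr_col_mx map_row_mx mul_row_block.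
  by rewrite trmx1 map_mx1 !(mul1mx, mulmx0, addr0, add0r).
have HV' : H *m col_mx X 1%:M = col_mx (Hhat *m X) 1%:M.
  by rewrite mul_block_col !(mul0mx, mulmx1, addr0, add0r).
rewrite mulmxDr mulmxDl !mulmxA -mulmxA LV HV -adjmxM LV -mulmxA HV'.
rewrite tr_col_mx map_row_mx !mul_row_col mul1mx mulmx1 adjmxZ.
by rewrite -scalemxAr -scalemxAl scalerDl addrACA mulmxA.
Qed.

Lemma possemidefmx_transfer_axis s : possemidefmx K ->
  (char_poly A).[s] != 0 -> s + Num.conj s = 0 ->
  possemidefmx (rmx_eval (transfer_function A B C D) s +
                (rmx_eval (transfer_function A B C D) s) ^t*).
Proof.
move=> pK chi0 s0; rewrite transfer_function_eval // -mulmxA.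
have := dissipation (char_poly_resolvent_unit chi0) pK.
by rewrite s0 scale0r add0r.
Qed.

Lemma possemidefmx_transfer_right s : possemidefmx K -> posdefmx (- Hhat) ->
  (char_poly A).[s] != 0 -> 0 <= s + Num.conj s ->
  possemidefmx (rmx_eval (transfer_function A B C D) s +
                (rmx_eval (transfer_function A B C D) s) ^t*).
Proof.
move=> pK [hH pH] chi0 s0; rewrite transfer_function_eval // -mulmxA.
have [hP pP] := dissipation (char_poly_resolvent_unit chi0) pK.
set X := invmx _ *m B in hP pP *; set Y := C *m X + D in hP pP *.
clearbody Y; clearbody X.
split=> [|u]; first by apply/hermsymmxP; rewrite adjmxD trmxCK addrC.
have /= := pP u; rewrite mulmxDr mulmxDl mxE -scalemxAr -scalemxAl mxE.
have -> : (u ^t* *m (X ^t* *m Hhat *m X) *m u) = - ((X *m u) ^t* *m - Hhat *m (X *m u)).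
  by rewrite adjmxM mulmxN mulNmx opprK !mulmxA.
rewrite [X in _ * X]mxE mulrN addrC subr_ge0; apply: le_trans; rewrite mulr_ge0 //.
have [->|Xu0] := eqVneq (X *m u) 0; last by rewrite ltW ?pH.
by rewrite mulmx0 mxE.
Qed.

Lemma char_poly_right_neq0 s : possemidefmx K -> posdefmx (- Hhat) ->
  0 < s + Num.conj s -> (char_poly A).[s] != 0.
Proof.
move=> /possemidefmx_state [_ pK] [_ pH] s0; apply/negP => chi0.
have : eigenvalue A s by rewrite eigenvalue_root_char.
rewrite -eigenvalue_trmx => /eigenvalueP [v vA v0]; pose x := v^T.
have x0 : x != 0 by rewrite trmx_eq0.
have Ax : A *m x = s *: x by rewrite -[A]trmxK -trmx_mul vA linearZ.
have := pK x; rewrite mulmxDr mulmxDl !mulmxA -adjmxM -mulmxA Ax adjmxZ.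
rewrite -scalemxAr -!scalemxAl -scalerDl mxE pmulr_rge0 // => xHx.
by have := pH x x0; rewrite mulmxN mulNmx mxE oppr_gt0 => /(le_lt_trans xHx); rewrite ltxx.
Qed.

Lemma count_right_leq : Hhat \is hermsymmx -> possemidefmx K ->
  (count (fun z : F => (0 < z + Num.conj z)%R) (rootseq (char_poly A)) +
   count (fun z : F => (z + Num.conj z < 0)%R) (rootseq (char_poly Hhat)) <= n)%N.
Proof.
move=> hH /possemidefmx_state pK.
have [X [T [AX fX pT]]] := invariant_subspace (fun z => 0 < z + Num.conj z) A.
have [N [U [HN fN pU]]] := invariant_subspace (fun z => z + Num.conj z < 0) Hhat.
exact: invariant_subspaces_leq hH pK AX fX pT HN fN pU.
Qed.

(** Replacing A and Hhat by their opposites preserves Hhat A + A^* Hhat and exchanges the two half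
    planes. *)
Lemma count_left_leq : Hhat \is hermsymmx -> possemidefmx K ->
  (count (fun z : F => (z + Num.conj z < 0)%R) (rootseq (char_poly A)) +
   count (fun z : F => (0 < z + Num.conj z)%R) (rootseq (char_poly Hhat)) <= n)%N.
Proof.
move=> hH /possemidefmx_state pK.
have [X [T [AX fX pT]]] := invariant_subspace (fun z => z + Num.conj z < 0) A.
have [N [U [HN fN pU]]] := invariant_subspace (fun z => 0 < z + Num.conj z) Hhat.
apply: (invariant_subspaces_leq (A := - A) (X := X) (T := - T) (N := N) (U := - U))
  (hermsymmxN hH) _ _ fX _ _ fN _.
- by rewrite adjmxN mulmxN !mulNmx mulmxN !opprK.
- by rewrite mulNmx AX mulmxN.
- by move=> a; rewrite eigenvalueN => /pT; rewrite rmorphN /= -opprD oppr_lt0.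
- by rewrite mulNmx HN mulmxN.
- by move=> a; rewrite eigenvalueN => /pU; rewrite rmorphN /= -opprD oppr_gt0.
Qed.

End Dissipation.

(** * Analyticity of rational functions and null sets of the imaginary axis *)

Lemma derivable_horner_num (K : numFieldType) (P : {poly K}) (s : K) :
  derivable (horner P : K^o -> K^o) s 1.
Proof.
elim/poly_ind: P => [|P c IH].
  have -> : horner (0 : {poly K}) = cst 0 by apply/funext => y; rewrite horner0.
  exact: derivable_cst.
have -> : horner (P * 'X + c%:P) = (horner P * id) + cst c :> (K^o -> K^o).
  by apply/funext => y; rewrite !hornerE.
by apply: derivableD; [apply: derivableM|exact: derivable_cst].
Qed.

Lemma derivable_reval (K : numFieldType) (f : ratfun K) (s : K) :
  (rden f).[s] != 0 -> derivable (reval f : K^o -> K^o) s 1.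
Proof.
move=> ds; apply: (@derivableM _ _ (horner (rnum f) : K^o -> K^o) (fun y => (rden f).[y]^-1)).
  exact: derivable_horner_num.
by apply: (@derivableV _ _ (horner (rden f) : K^o -> K^o)); last exact: derivable_horner_num.
Qed.

Section ComplexPlane.
Variable R : realType.

(** In a [numClosedFieldType] the half planes are expressed through [z + Num.conj z]; over [R[i]]
    this is twice the real part. *)
Lemma gt0_addcJ (z : R[i]) : (0 < z + Num.conj z) = (0 < complex.Re z).
Proof.
rewrite addcJ -[2]/(1 + 1) mulrDl mul1r -rmorphD /= ltcR.
by rewrite -mulr2n pmulrn_lgt0.
Qed.

Lemma lt0_addcJ (z : R[i]) : (z + Num.conj z < 0) = (complex.Re z < 0).
Proof.
rewrite addcJ -[2]/(1 + 1) mulrDl mul1r -rmorphD /= ltcR.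
by rewrite -mulr2n pmulrn_llt0.
Qed.

Lemma imag_add_conj (w : R) : (0 +i* w) + Num.conj (0 +i* w) = 0.
Proof. by rewrite addcJ /= mulr0. Qed.

(** The exceptional [w] are imaginary parts of roots of [P], hence finite in number. *)
Lemma ae_imaginary_axis (P : {poly R[i]}) : P != 0 ->
  {ae (@lebesgue_measure R), forall w : R, P.[0 +i* w] != 0}.
Proof.
move=> P0; pose Z : set R := @complex.Im R @` [set` rootseq P].
have cZ : countable Z by exact/finite_set_countable/finite_image/finite_seq.
have nZ : (@lebesgue_measure R).-negligible Z.
  apply/negligibleP; last exact: countable_lebesgue_measure0.
  exact: countable_measurable.
apply: negligibleS nZ => w /= /negP; rewrite negbK => Pw.
by exists (0 +i* w) => //=; rewrite mem_rootseq.
Qed.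

End ComplexPlane.

Theorem proposition4p2 (R : realType) (n p q : nat)
    (A : 'M[R[i]]_n) (B : 'M[R[i]]_(n, p)) (C : 'M[R[i]]_(p, n)) (D : 'M[R[i]]_p)
    (Psi : 'M[ratfun R[i]]_p) (L H : 'M[R[i]]_(n + p)) (Hhat : 'M[R[i]]_n) :
  Psi = transfer_function A B C D ->
  mcmillan_degree Psi = q ->
  (q <= n)%N ->
  L = block_mx A B C D ->
  Hhat \is hermsymmx ->
  H = block_mx Hhat 0 0 1%:M ->
  possemidefmx (H *m L + L ^t* *m H) ->
  (forall nu : nat, (nu <= n)%N ->
     inertia Hhat = (nu, 0%N, (n - nu)%N) ->
     [/\ generalized_positive_function Psi,
         (nb_poles_left Psi <= nu)%N &
         (nb_poles_right Psi <= n - nu)%N]) /\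
  (posdefmx (- Hhat) -> positive_function Psi).
Proof.
move=> -> _ _ -> hH -> pK.
have chi_neq0 : char_poly A != 0 by rewrite monic_neq0 ?char_poly_monic.
split=> [nu nu_n [negH _ posH]|pH].
  split.
  - have := ae_imaginary_axis chi_neq0; apply: negligibleS => w /=.
    apply: contra_not => chi_w.
    exact: possemidefmx_transfer_axis pK chi_w (imag_add_conj w).
  - apply: leq_trans (count_rootseq_dvdp _ chi_neq0 (pole_poly_dvdp A B C D)) _.
    (* With n - nu positive eigenvalues of [Hhat], the count is at most n - (n - nu), which equals
       nu because nu <= n. *)
    have := count_left_leq hH pK.
    rewrite (eq_count (lt0_addcJ (R := R))) (eq_count (gt0_addcJ (R := R))) posH.
    by rewrite addnC -leq_subRL ?leq_subr // subKn.
  - apply: leq_trans (count_rootseq_dvdp _ chi_neq0 (pole_poly_dvdp A B C D)) _.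
    have := count_right_leq hH pK.
    rewrite (eq_count (lt0_addcJ (R := R))) (eq_count (gt0_addcJ (R := R))) negH.
    by rewrite addnC -leq_subRL.
split=> [i j s s_gt0|s s_gt0]; rewrite -gt0_addcJ in s_gt0.
  (* The reduced denominator of each entry divides [char_poly A], which has no root in the open
     right half plane. *)
  apply: derivable_reval; have := char_poly_right_neq0 pK pH s_gt0.
  apply: contraNneq => ds.
  have /dvdpP [c ->] := rden_dvdp (transfer_function_num A B C D i j).
  by rewrite hornerM ds mulr0.
have chi_s := char_poly_right_neq0 pK pH s_gt0.
exact: possemidefmx_transfer_right pK pH chi_s (ltW s_gt0).
Qed.
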